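(* $\displaystyle\sum_{n\ge1}|\Pi_n(1/24/3)|\,z^n=\frac{z-4z^2+6z^3-2z^4}{(1-3z+2z^2)^2}.$
   Context: The standardization of a set partition of a finite set $S\subset\mathbb{Z}_{>0}$ replaces the $i$-th smallest element of $S$ by $i$. A set partition $\pi$ of $[n]$ contains $\tau\vdash[k]$ if for some $S\subseteq[n]$ the standardization of the restriction of $\pi$ to $S$ is $\tau$; otherwise it avoids $\tau$. $\Pi_n(\tau)$ is the set of partitions of $[n]$ avoiding $\tau$. $1/24/3$ is the partition of $[4]$ with blocks $\{1\},\{2,4\},\{3\}$. *)

(* Defs.v *)
From HB Require Import structures.
From mathcomp Require Import all_boot all_order all_algebra.
From mathcomp Require Import boolp.

Set Implicit Arguments.
Unset Strict Implicit.
Unset Printing Implicit Defensive.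

Import GRing.Theory.

(* The ground set [n] = {1, ..., n} is 'I_n: the ordinal with value i stands
   for i + 1. *)
Section SetPartitions.

Definition restrict n (S : {set 'I_n}) (P : {set {set 'I_n}}) :
    {set {set 'I_n}} :=
  [set B :&: S | B in P] :\ set0.

Definition rank_in n (S : {set 'I_n}) (x : 'I_n) : nat :=
  #|[set y in S | y < x]|.

(* Meaningful for Q a partition of S with k = #|S|, so that the ranks of the
   elements of S exhaust 'I_k; [k] is a separate parameter so that the result
   can be compared with a pattern without a cast. *)
Definition standardize n k (S : {set 'I_n}) (Q : {set {set 'I_n}}) :
    {set {set 'I_k}} :=
  [set [set i : 'I_k | [exists x in B, rank_in S x == i]]
     | B : {set 'I_n} in Q].

Definition contains n k (P : {set {set 'I_n}}) (tau : {set {set 'I_k}}) : bool :=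
  [exists S : {set 'I_n},
     (#|S| == k) && (standardize k S (restrict S P) == tau)].

Definition avoids n k (P : {set {set 'I_n}}) (tau : {set {set 'I_k}}) : bool :=
  ~~ contains P tau.

Definition avoiders n k (tau : {set {set 'I_k}}) : {set {set {set 'I_n}}} :=
  [set P | partition P [set: 'I_n] & avoids P tau].

Definition tau_1_24_3 : {set {set 'I_4}} :=
  [set [set inord 0]; [set inord 1; inord 3]; [set inord 2]].

Lemma tau_1_24_3_partition : partition tau_1_24_3 [set: 'I_4].
Proof.
have E0 : inord 0 = @Ordinal 4 0 isT by apply: val_inj; rewrite /= inordK.
have E1 : inord 1 = @Ordinal 4 1 isT by apply: val_inj; rewrite /= inordK.
have E2 : inord 2 = @Ordinal 4 2 isT by apply: val_inj; rewrite /= inordK.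
have E3 : inord 3 = @Ordinal 4 3 isT by apply: val_inj; rewrite /= inordK.
rewrite /tau_1_24_3 E0 E1 E2 E3; apply/and3P; split.
- rewrite eqEsubset subsetT /=; apply/subsetP => x _; apply/bigcupP.
  case: x => -[|[|[|[|//]]]] hx.
  + by exists [set Ordinal (isT : 0 < 4)]; rewrite !inE ?eqxx.
  + exists [set Ordinal (isT : 1 < 4); Ordinal (isT : 3 < 4)];
      by rewrite !inE ?eqxx ?orbT.
  + by exists [set Ordinal (isT : 2 < 4)]; rewrite !inE ?eqxx ?orbT.
  + exists [set Ordinal (isT : 1 < 4); Ordinal (isT : 3 < 4)];
      by rewrite !inE ?eqxx ?orbT.
- apply/trivIsetP => A B; rewrite !inE -!orbA.
  case/or3P => /eqP -> /or3P[] /eqP ->; rewrite ?eqxx // => _;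
    by rewrite -setI_eq0; apply/eqP/setP => -[[|[|[|[|//]]]] hx]; rewrite !inE.
- rewrite !inE !negb_or -!andbA; apply/and3P; split; apply/negP => /eqP/setP.
  + by move=> /(_ (Ordinal (isT : 0 < 4))); rewrite !inE.
  + by move=> /(_ (Ordinal (isT : 1 < 4))); rewrite !inE.
  + by move=> /(_ (Ordinal (isT : 2 < 4))); rewrite !inE.
Qed.

End SetPartitions.

Local Open Scope ring_scope.

(* The ring R[[z]] of formal power series.  The wrapper keeps the Cauchy
   product apart from the pointwise structure of functions nat -> R. *)
Record fps (R : Type) := FPS { fcoef : nat -> R }.

HB.instance Definition _ (R : Type) := gen_eqMixin (fps R).
HB.instance Definition _ (R : Type) := gen_choiceMixin (fps R).

Lemma fpsP (R : Type) (f g : fps R) : fcoef f =1 fcoef g <-> f = g.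
Proof. by split=> [|-> //]; case: f g => f [g] /= /funext ->. Qed.

Section FpsZmodule.
Variable R : zmodType.
Implicit Types f g h : fps R.

Definition fps_zero : fps R := FPS (fun=> 0).
Definition fps_opp f : fps R := FPS (fun n => - fcoef f n).
Definition fps_add f g : fps R := FPS (fun n => fcoef f n + fcoef g n).

Fact fps_addA : associative fps_add.
Proof. by move=> f g h; apply/fpsP => n; rewrite /= addrA. Qed.
Fact fps_addC : commutative fps_add.
Proof. by move=> f g; apply/fpsP => n; rewrite /= addrC. Qed.
Fact fps_add0 : left_id fps_zero fps_add.
Proof. by move=> f; apply/fpsP => n; rewrite /= add0r. Qed.
Fact fps_addN : left_inverse fps_zero fps_opp fps_add.
Proof. by move=> f; apply/fpsP => n; rewrite /= addNr. Qed.

HB.instance Definition _ := GRing.isZmodule.Build (fps R)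
  fps_addA fps_addC fps_add0 fps_addN.

End FpsZmodule.

Section FpsRing.
Variable R : comNzRingType.
Implicit Types f g h : fps R.

Definition fps_one : fps R := FPS (fun n => (n == 0%N)%:R).
Definition fps_mul f g : fps R :=
  FPS (fun n => \sum_(i < n.+1) fcoef f i * fcoef g (n - i)).

Fact fps_mulC : commutative fps_mul.
Proof.
move=> f g; apply/fpsP => n /=; rewrite (reindex_inj rev_ord_inj) /=.
by apply: eq_bigr => i _; rewrite mulrC !subSS subKn // -ltnS.
Qed.

Fact fps_mulA : associative fps_mul.
Proof.
move=> f g h; rewrite (fps_mulC g h); apply/fpsP => n.
rewrite (fps_mulC (fps_mul f g) h) /=.
pose c3 j k := fcoef f j * (fcoef h k * fcoef g (n - j - k)).
transitivity (\sum_(j < n.+1) \sum_(k < n.+1 | (k <= n - j)%N) c3 j k).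
  apply: eq_bigr => /= j _; rewrite big_distrr /=.
  by rewrite (big_ord_narrow_leq (leq_subr _ _)).
rewrite (exchange_big_dep predT) //=; apply: eq_bigr => k _.
transitivity (\sum_(j < n.+1 | (j <= n - k)%N) c3 j k).
  apply: eq_bigl => j; rewrite -ltnS -(ltnS j) -!subSn ?leq_ord //.
  by rewrite -subn_gt0 -(subn_gt0 j) -!subnDA addnC.
rewrite (big_ord_narrow_leq (leq_subr _ _)) big_distrr /=.
by apply: eq_bigr => j _; rewrite /c3 -!subnDA addnC mulrCA.
Qed.

Fact fps_mul1 : left_id fps_one fps_mul.
Proof.
move=> f; apply/fpsP => n /=; rewrite big_ord_recl /= subn0 mul1r.
by rewrite big1 ?addr0 // => i _; rewrite mul0r.
Qed.

Fact fps_mulDl : left_distributive fps_mul +%R.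
Proof.
move=> f g h; apply/fpsP => n /=; rewrite -big_split /=.
by apply: eq_bigr => i _; rewrite mulrDl.
Qed.

Fact fps_one_neq0 : fps_one != 0.
Proof. by apply/eqP => /fpsP/(_ 0%N)/= /eqP; rewrite oner_eq0. Qed.

HB.instance Definition _ := GRing.Zmodule_isComNzRing.Build (fps R)
  fps_mulA fps_mulC fps_mul1 fps_mulDl fps_one_neq0.

Definition fpsX : fps R := FPS (fun n => (n == 1%N)%:R).

Lemma fcoefM f g n :
  fcoef (f * g) n = \sum_(i < n.+1) fcoef f i * fcoef g (n - i).
Proof. by []. Qed.

Lemma fcoef1 n : fcoef (1 : fps R) n = (n == 0%N)%:R.
Proof. by []. Qed.

End FpsRing.

Section FpsUnitRing.
Variable R : comUnitRingType.
Implicit Types f g h : fps R.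

Definition fps_unit : {pred fps R} := [pred f | fcoef f 0 \is a GRing.unit].

(* The first n + 1 coefficients b_0, ..., b_n of the inverse of f, from
   f_0 b_0 = 1 and f_0 b_n = - \sum_(1 <= i <= n) f_i b_(n - i). *)
Fixpoint fps_inv_seq f (n : nat) : seq R :=
  if n is m.+1 then
    let s := fps_inv_seq f m in
    rcons s (- (fcoef f 0)^-1 * \sum_(i < n) fcoef f i.+1 * s`_(m - i))
  else [:: (fcoef f 0)^-1].

Definition fps_inv f : fps R :=
  if f \in fps_unit then FPS (fun n => (fps_inv_seq f n)`_n) else f.

Lemma size_fps_inv_seq f n : size (fps_inv_seq f n) = n.+1.
Proof. by elim: n => //= n IH; rewrite size_rcons IH. Qed.

Lemma nth_fps_inv_seq f n i : (i <= n)%N ->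
  (fps_inv_seq f n)`_i = (fps_inv_seq f i)`_i.
Proof.
elim: n => [|n IH]; first by rewrite leqn0 => /eqP ->.
rewrite leq_eqVlt => /predU1P[-> //|]; rewrite ltnS => le_in /=.
by rewrite nth_rcons size_fps_inv_seq ltnS le_in IH.
Qed.

Fact fps_mulVr : {in fps_unit, left_inverse 1 fps_inv *%R}.
Proof.
move=> f uf; rewrite mulrC; apply/fpsP => n.
rewrite /fps_inv uf fcoefM fcoef1 big_ord_recl subn0.
case: n => [|n]; first by rewrite big_ord0 addr0 /= mulrV.
rewrite [X in _ * X + _]/= nth_rcons size_fps_inv_seq ltnn eqxx.
rewrite mulNr mulrN mulVKr //; apply/eqP; rewrite addrC subr_eq0; apply/eqP.
apply: eq_bigr => i _.
by rewrite [LHS]/= [in RHS]nth_fps_inv_seq ?leq_subr // /bump /= subSS.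
Qed.

Fact fps_unitPl f g : g * f = 1 -> f \in fps_unit.
Proof.
move/fpsP/(_ 0%N); rewrite fcoefM big_ord1 fcoef1 /= => gf1.
by apply/unitrPr; exists (fcoef g 0); rewrite mulrC.
Qed.

Fact fps_inv_out : {in [predC fps_unit], fps_inv =1 id}.
Proof. by move=> f; rewrite inE /= /fps_inv => /negbTE ->. Qed.

HB.instance Definition _ := GRing.ComNzRing_hasMulInverse.Build (fps R)
  fps_mulVr fps_unitPl fps_inv_out.

Lemma fps_unitE f : (f \is a GRing.unit) = (fcoef f 0 \is a GRing.unit).
Proof. by []. Qed.

End FpsUnitRing.

(* The ordinary generating function \sum_(n >= 1) a_n z^n; the value a 0 is
   not used. *)
Definition ogf1 (R : nzRingType) (a : nat -> nat) : fps R :=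
  FPS (fun n => if n is 0 then 0 else (a n)%:R).

(* Main.v *)
Require Import Defs.
From mathcomp Require Import all_boot all_order all_algebra ring lra zify.

(* A partition of [n] is encoded by the word whose i-th letter is the least
   element of the block of i, so that words are built from left to right: the
   next letter is an old one or the length of the word. The partition contains
   1/24/3 iff its word has a subword x y z y with x, y, z distinct. Whether an
   avoiding word may be extended by a given old letter is governed by six
   states, and in each of them the number of avoiding extensions by k letters
   depends on k only: starting from the word 0 it is k + 3 + (k - 2) 2^k. *)

Set Implicit Arguments.
Unset Strict Implicit.
Unset Printing Implicit Defensive.
Import Order.TTheory GRing.Theory Num.Theory.

(** * Words avoiding x y z y, and the letters that may not be appended *)

Section Words.
Implicit Types (w : seq nat) (c e k l : nat).

(** [subseq] compares first letters; reversing both words turns the comparison of last letters into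
    that computation. *)
Lemma subseq_rcons_rcons (T : eqType) (s w : seq T) (y c : T) :
  subseq (rcons s y) (rcons w c) =
  subseq (rcons s y) w || (y == c) && subseq s w.
Proof.
rewrite -[LHS]subseq_rev -(subseq_rev _ w) -(subseq_rev s) !rev_rcons /=.
case: eqP => _ /=; last by rewrite orbF.
apply/esym/orb_idl; apply: subseq_trans; exact: subseq_cons.
Qed.

(** Stated over any [eqType], because it is applied both to words of numbers and to the sequence of
    blocks [pblock P i]. *)
Definition pattern (T : eqType) (w : seq T) : Prop :=
  exists x y z : T, uniq [:: x; y; z] /\ subseq [:: x; y; z; y] w.

(** For [e] different from [c], this is the condition under which appending [e] makes [c] bad: it
    creates a subword x c e with distinct letters. *)
Definition precedes w c e : bool :=
  has (fun x => [&& x != c, x != e & subseq [:: x; c] w]) w.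

(** Appending [c] would complete an occurrence x c z c of the pattern. *)
Definition bad w c : bool :=
  has (fun z => (z != c) &&
    has (fun x => [&& x != c, x != z & subseq [:: x; c; z] w]) w) w.

Lemma precedesP w c e :
  reflect (exists x, [/\ x != c, x != e & subseq [:: x; c] w])
          (precedes w c e).
Proof.
apply: (iffP hasP) => [[x _ /and3P[]]|[x [xc xe xcw]]]; first by exists x.
by exists x; [apply: (mem_subseq xcw); rewrite inE eqxx|apply/and3P].
Qed.

Lemma badP w c :
  reflect (exists x z, uniq [:: x; c; z] /\ subseq [:: x; c; z] w) (bad w c).
Proof.
apply: (iffP hasP) => [[z _ /andP[zc /hasP[x _ /and3P[xc xz sw]]]]|].
  by exists x, z; rewrite /= !inE negb_or xc xz eq_sym zc.
case=> x [z [/= + sw]]; rewrite !inE negb_or andbT => /andP[/andP[xc xz] cz].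
have mw t : t \in [:: x; c; z] -> t \in w by apply: mem_subseq.
exists z; first by apply: mw; rewrite !inE eqxx !orbT.
rewrite eq_sym cz; apply/hasP; exists x; first by apply: mw; rewrite inE eqxx.
by rewrite xc xz.
Qed.

Lemma bad_rcons w c e :
  bad (rcons w e) c = bad w c || (c != e) && precedes w c e.
Proof.
apply/idP/orP => [/badP[x [z [u]]]|[/badP[x [z [u sw]]]|]].
- rewrite (subseq_rcons_rcons [:: x; c]) => /orP[sw|/andP[/eqP ez sw]].
    by left; apply/badP; exists x, z.
  right; move: u; rewrite -ez /= !inE negb_or andbT.
  case/andP=> /andP[xc xz] ->.
  by apply/precedesP; exists x.
- apply/badP; exists x, z; split=> //.
  exact: subseq_trans sw (subseq_rcons _ _).
case/andP=> ce /precedesP[x [xc xe sw]]; apply/badP; exists x, e.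
rewrite (subseq_rcons_rcons [:: x; c]) eqxx sw orbT.
by rewrite /= !inE negb_or xc xe ce.
Qed.

Lemma pattern_rcons w c : pattern (rcons w c) <-> pattern w \/ bad w c.
Proof.
split=> [[x [y [z [u]]]]|[[x [y [z [u sw]]]]|/badP[x [z [u sw]]]]].
- rewrite (subseq_rcons_rcons [:: x; y; z]) => /orP[sw|/andP[/eqP <- sw]].
    by left; exists x, y, z.
  by right; apply/badP; exists x, z.
- exists x, y, z; split=> //; exact: subseq_trans sw (subseq_rcons _ _).
- exists x, c, z; split=> //.
  by rewrite (subseq_rcons_rcons [:: x; c; z]) eqxx sw orbT.
Qed.

(** These words are normal forms up to renaming of letters, one for each set partition of the
    positions. *)
Definition canonical w : bool := all (fun x => index x w == x) w.

Lemma canonical_lt w x : canonical w -> x \in w -> x < size w.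
Proof. by move=> /allP cw xw; rewrite -{1}(eqP (cw x xw)) index_mem. Qed.

Lemma canonical_rcons w c :
  canonical (rcons w c) = canonical w && ((c \in w) || (c == size w)).
Proof.
rewrite /canonical all_rcons andbC -cats1 index_cat.
rewrite (eq_in_all (a2 := fun x => index x w == x)); last first.
  by move=> x xw; rewrite index_cat xw.
case: allP => //= cw; case: ifP => [/cw //|_].
by rewrite /= eqxx addn0 eq_sym.
Qed.

Lemma canonical_size_notin w : canonical w -> size w \notin w.
Proof. by move=> cw; apply/negP => /(canonical_lt cw); rewrite ltnn. Qed.

Lemma canonical_rcons_mem w c : canonical w -> c \in w -> canonical (rcons w c).
Proof. by move=> cw mc; rewrite canonical_rcons cw mc. Qed.

Lemma canonical_rcons_size w : canonical w -> canonical (rcons w (size w)).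
Proof. by move=> cw; rewrite canonical_rcons cw eqxx orbT. Qed.

Lemma bad_mem w c : bad w c -> c \in w.
Proof.
by case/badP=> x [z [_ sw]]; apply: (mem_subseq sw); rewrite !inE eqxx orbT.
Qed.

Lemma precedes_diag w c e : precedes w c e -> precedes w c c.
Proof. by case/precedesP=> x [xc _ sw]; apply/precedesP; exists x. Qed.

(** A witness is a letter of [w], so it differs from [e] automatically. *)
Lemma precedes_new w c e : e \notin w -> precedes w c e = precedes w c c.
Proof.
move=> ew; apply/idP/idP; first exact: precedes_diag.
case/precedesP=> x [xc _ sw]; apply/precedesP; exists x; split=> //.
apply: contraNneq ew => <-; apply: (mem_subseq sw); exact: mem_head.
Qed.

Lemma precedes_rcons w a c e :
  precedes (rcons w a) c e =
  precedes w c e || (c == a) && has (fun x => (x != c) && (x != e)) w.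
Proof.
apply/idP/orP => [/precedesP[x [xc xe]]|[/precedesP[x [xc xe sw]]|]].
- rewrite (subseq_rcons_rcons [:: x]) sub1seq => /orP[sw|/andP[-> xw]].
    by left; apply/precedesP; exists x.
  by right; apply/hasP; exists x => //; apply/andP.
- apply/precedesP; exists x; split=> //.
  exact: subseq_trans sw (subseq_rcons _ _).
case/andP=> /eqP-> /hasP[x xw /andP[xc xe]]; apply/precedesP; exists x.
by rewrite (subseq_rcons_rcons [:: x]) eqxx sub1seq xw orbT.
Qed.

Lemma canonical0 w c : canonical w -> c \in w -> 0 \in w.
Proof.
by case: w => // x w /= /andP[/=]; rewrite eqxx => /eqP<- _; rewrite mem_head.
Qed.

(** A nonempty canonical word begins with 0, and this leading 0 is the witness. *)
Lemma precedes_zero w c e :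
  canonical w -> c \in w -> c != 0 -> e != 0 -> precedes w c e.
Proof.
case: w => // x w /= /andP[/=]; rewrite eqxx => /eqP<- _.
rewrite inE => /orP[/eqP->//|cw] c0 e0; apply/precedesP; exists 0.
by rewrite eq_sym c0 eq_sym e0 /= sub1seq.
Qed.

(** * Generation of the avoiding words letter by letter *)

Definition children w : seq (seq nat) :=
  [seq rcons w c | c <- undup w ++ [:: size w] & ~~ bad w c].

Definition next_words (ws : seq (seq nat)) : seq (seq nat) :=
  flatten (map children ws).

Definition extensions k w : nat := size (iter k next_words [:: w]).

Lemma size_iter_next_words k ws :
  size (iter k next_words ws) = \sum_(w <- ws) extensions k w.
Proof.
elim: ws => [|w ws IH].
  by rewrite big_nil; elim: k => //= k /size0nil ->.
rewrite big_cons -IH /extensions -size_cat; congr size.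
by elim: k {IH} => //= k ->; rewrite /next_words map_cat flatten_cat.
Qed.

(** [L] lists the old letters that may be repeated. The new letter [size w] is never bad, since a
    bad letter already occurs, so the children are given, up to order, by [rcons L (size w)]. *)
Lemma extensionsS k w L :
  canonical w -> uniq L -> {subset L <= w} ->
  {in w, forall c, bad w c = (c \notin L)} ->
  extensions k.+1 w = \sum_(c <- rcons L (size w)) extensions k (rcons w c).
Proof.
move=> cw uL sL bL; have nw := canonical_size_notin cw.
rewrite /extensions iterSr size_iter_next_words /next_words /= cats0.
rewrite big_map; apply: perm_big; apply: uniq_perm.
- rewrite filter_uniq // cat_uniq undup_uniq /= orbF andbT mem_undup //.
- by rewrite rcons_uniq uL andbT; apply: contra nw; apply: sL.
move=> c; rewrite mem_filter mem_cat mem_undup mem_rcons !inE.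
case cw': (c \in w); first rewrite bL // negbK andbT.
  by case: eqP => // ec; rewrite -ec cw' in nw.
rewrite orFb; case: eqP => [->|_].
  by rewrite (contra _ nw) //; apply: bad_mem.
rewrite andbF; apply/esym/negP => /sL; by rewrite cw'.
Qed.

(* The states of an avoiding canonical word, its letters being written 1, 2, ...
   in order of first occurrence: state1 is 1^a; state2 false is 1^a 2^b and
   state2 true the other words in 1 and 2; state3 is 1^a 2^b 3^c ... l^d;
   state_zero is a word in state3 followed by some 1s; in state_last only the
   last letter can be repeated. The first letter 1 is the natural number 0. *)
Definition state1 w := forall c, (c \in w) = (c == 0).

Definition state2 b l w :=
  [/\ l != 0, forall c, (c \in w) = (c \in [:: 0; l]) & precedes w 0 0 = b].

Definition state3 l w :=
  [/\ l != 0, l \in w, {in w, forall c, bad w c = (c \notin [:: 0; l])},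
      ~~ precedes w 0 0 & precedes w l 0].

Definition state_zero w :=
  [/\ 0 \in w, {in w, forall c, bad w c = (c \notin [:: 0])} &
      precedes w 0 0].

Definition state_last l w :=
  [/\ l != 0, l \in w & {in w, forall c, bad w c = (c \notin [:: l])}].

(** * Transitions between the states *)

Lemma not_bad_new w : canonical w -> bad w (size w) = false.
Proof.
move=> cw; apply/negP => /bad_mem; apply/negP; exact: canonical_size_notin.
Qed.

Lemma size_neq0 w c : c \in w -> size w != 0.
Proof. by case: w. Qed.

Lemma precedes_rcons_l w a c e : precedes w c e -> precedes (rcons w a) c e.
Proof. by rewrite precedes_rcons => ->. Qed.

Lemma state_last_last l w : state_last l w -> state_last l (rcons w l).
Proof.
case=> l0 lw bw; split=> // [|c]; first by rewrite mem_rcons mem_head.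
rewrite mem_rcons bad_rcons !inE.
have [-> _|cl /= /bw ->] := eqVneq c l; first by rewrite bw // inE eqxx.
by rewrite inE cl.
Qed.

(** The leading 0 stands before [l], so the new letter makes [l] bad and takes over its role. *)
Lemma state_last_new l w :
  canonical w -> state_last l w -> state_last (size w) (rcons w (size w)).
Proof.
move=> cw [l0 lw bw]; split; first exact: size_neq0 lw.
  by rewrite mem_rcons mem_head.
move=> c; rewrite mem_rcons bad_rcons !inE.
have [-> _|cn /= cw'] := eqVneq c (size w); first by rewrite not_bad_new.
rewrite bw // inE; have [->|//] := eqVneq c l.
by rewrite (precedes_zero cw) // (size_neq0 lw).
Qed.

Lemma state_zero_zero w : state_zero w -> state_zero (rcons w 0).
Proof.
case=> w0 bw p0; split; last exact: precedes_rcons_l.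
  by rewrite mem_rcons mem_head.
move=> c; rewrite mem_rcons bad_rcons !inE.
have [-> _|c0 /= /bw ->] := eqVneq c 0; first by rewrite bw // inE eqxx.
by rewrite inE c0.
Qed.

(** Some nonzero letter stands before a 0, so the new letter makes 0 bad as well. *)
Lemma state_zero_new w :
  canonical w -> state_zero w -> state_last (size w) (rcons w (size w)).
Proof.
move=> cw [w0 bw p0]; split; first exact: size_neq0 w0.
  by rewrite mem_rcons mem_head.
move=> c; rewrite mem_rcons bad_rcons !inE.
have [-> _|cn /= cw'] := eqVneq c (size w); first by rewrite not_bad_new.
rewrite bw // inE; have [->|//] := eqVneq c 0.
by rewrite precedes_new ?canonical_size_notin.
Qed.

Lemma state3_last l w : state3 l w -> state3 l (rcons w l).
Proof.
case=> l0 lw bw n0 pl; split=> //; last exact: precedes_rcons_l.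
- by rewrite mem_rcons mem_head.
- move=> c; rewrite mem_rcons bad_rcons !inE.
  have [-> _|cl /= cw] := eqVneq c l.
    by rewrite bw // !inE eqxx orbT.
  rewrite bw // !inE negb_or cl andbT; have [->|//] := eqVneq c 0.
  by apply: contraNF n0; apply: precedes_diag.
by rewrite precedes_rcons (negbTE n0) eq_sym (negbTE l0).
Qed.

(** The last clause of [state3] gives a third letter before [l], so appending 0 makes [l] bad; [l]
    itself then stands before a 0. *)
Lemma state3_zero l w : canonical w -> state3 l w -> state_zero (rcons w 0).
Proof.
move=> cw [l0 lw bw n0 pl]; split.
- by rewrite mem_rcons mem_head.
- move=> c; rewrite mem_rcons bad_rcons !inE.
  have [-> _|c0 /= cw'] := eqVneq c 0.
    by rewrite bw ?(canonical0 cw lw) // !inE eqxx.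
  by rewrite bw // !inE (negbTE c0); have [->|] := eqVneq c l.
rewrite precedes_rcons eqxx; apply/orP; right; apply/hasP; exists l => //.
by rewrite l0.
Qed.

(** The leading 0 makes the old [l] bad, whereas 0 remains allowed because no other letter precedes
    a 0. The old [l] is the nonzero letter required before the new one. *)
Lemma state3_new l w :
  canonical w -> state3 l w -> state3 (size w) (rcons w (size w)).
Proof.
move=> cw [l0 lw bw n0 pl]; have nw0 := size_neq0 lw.
have nw := canonical_size_notin cw.
split=> //.
- by rewrite mem_rcons mem_head.
- move=> c; rewrite mem_rcons bad_rcons !inE.
  have [-> _|cn /= cw'] := eqVneq c (size w).
    by rewrite not_bad_new // orbT.
  rewrite bw // !inE orbF; have [->|c0] := eqVneq c 0.
    by rewrite precedes_new // (negbTE n0).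
  have [->|//] := eqVneq c l.
  by rewrite (precedes_zero cw).
- by rewrite precedes_rcons (negbTE n0) eq_sym (negbTE nw0).
rewrite precedes_rcons eqxx; apply/orP; right; apply/hasP; exists l => //.
by rewrite l0 andbT; apply: contraNneq nw => <-.
Qed.

Lemma state2_not_bad b l w c : state2 b l w -> bad w c = false.
Proof.
case=> _ lw _; apply/negP => /badP[x [z [u sw]]].
(* Three distinct letters do not fit into a two-letter alphabet. *)
have /(uniq_leq_size u) : {subset [:: x; c; z] <= [:: 0; l]}.
  by move=> t ts; rewrite -lw (mem_subseq sw).
by [].
Qed.

(** The flag records whether a 0 occurs after an [l]; as [l] is already present, appending 0 sets
    it, and appending [l] leaves it unchanged. *)
Lemma state2_old b l a w : state2 b l w -> a \in [:: 0; l] ->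
  state2 ((a == 0) || b) l (rcons w a).
Proof.
case=> l0 lw pw al; split=> // [c|].
  by rewrite mem_rcons inE lw; have [->|] := eqVneq c a; first by rewrite al.
rewrite precedes_rcons pw orbC eq_sym; case: (a == 0) => //.
congr orb; apply/hasP; exists l; last by rewrite l0.
by rewrite lw !inE eqxx orbT.
Qed.

(** A third letter always makes [l] bad, through the leading 0; it makes 0 bad exactly when [b]
    holds. *)
Lemma state2_new b l w : canonical w -> state2 b l w ->
  if b then state_last (size w) (rcons w (size w))
  else state3 (size w) (rcons w (size w)).
Proof.
move=> cw sw; have nb := state2_not_bad _ sw; have [l0 lw pw] := sw.
have w0 : 0 \in w by rewrite lw mem_head.
have wl : l \in w by rewrite lw !inE eqxx orbT.
have nw0 := size_neq0 w0; have nw := canonical_size_notin cw.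
have bw c : c \in rcons w (size w) -> bad (rcons w (size w)) c =
    (c != size w) && ((c != 0) || b).
  rewrite mem_rcons bad_rcons !inE nb.
  have [//|cn /=] := eqVneq c (size w).
  have [->|c0 cw'] := eqVneq c 0; first by rewrite precedes_new.
  by rewrite precedes_zero.
have nl : size w \in rcons w (size w) by rewrite mem_rcons mem_head.
case: b pw bw {sw} => pw bw; split=> //.
- by move=> c /bw ->; rewrite !inE orbT andbT.
- by move=> c /bw ->; rewrite !inE orbF negb_or andbC.
- by rewrite precedes_rcons pw eq_sym (negbTE nw0).
rewrite precedes_rcons eqxx; apply/orP; right; apply/hasP; exists l => //.
by rewrite l0 andbT; apply: contraNneq nw => <-.
Qed.

Lemma state1_zero w : state1 w -> state1 (rcons w 0).
Proof. by move=> w1 c; rewrite mem_rcons inE w1 orbb. Qed.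

Lemma state1_new w : state1 w -> state2 false (size w) (rcons w (size w)).
Proof.
move=> w1; have w0 : 0 \in w by rewrite w1.
have nw0 := size_neq0 w0; split=> // [c|].
  by rewrite mem_rcons !inE w1 orbC.
rewrite precedes_rcons eq_sym (negbTE nw0) orbF.
apply/negP => /precedesP[x [x0 _ /mem_subseq/(_ x)]].
by rewrite mem_head w1 (negbTE x0) => /(_ isT).
Qed.

(** * Number of extensions in each state *)

Lemma extensions_last k l w :
  canonical w -> state_last l w -> extensions k w = 2 ^ k.
Proof.
elim: k l w => // k IH l w cw sw; have [l0 lw bw] := sw.
rewrite (extensionsS _ cw _ _ bw) //; last by move=> c; rewrite inE => /eqP->.
rewrite /= !big_cons big_nil addn0.
rewrite (IH l) ?canonical_rcons_mem //; last exact: state_last_last.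
rewrite (IH (size w)) ?canonical_rcons_size //; last exact: state_last_new sw.
by rewrite expnS mul2n addnn.
Qed.

Lemma extensions_zero k w :
  canonical w -> state_zero w -> extensions k w = 2 ^ k.
Proof.
elim: k w => // k IH w cw sw; have [w0 bw _] := sw.
rewrite (extensionsS _ cw _ _ bw) //; last by move=> c; rewrite inE => /eqP->.
rewrite /= !big_cons big_nil addn0.
rewrite IH ?canonical_rcons_mem //; last exact: state_zero_zero.
rewrite (extensions_last _ _ (state_zero_new cw sw)) ?canonical_rcons_size //.
by rewrite expnS mul2n addnn.
Qed.

(** Appending 0 leads to [state_zero], the other two letters back to [state3], so E(k+1) = 2^k + 2
    E(k). Doubling avoids the exponent k - 1. *)
Lemma extensions3 k l w : canonical w -> state3 l w ->
  2 * extensions k w = k.+2 * 2 ^ k.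
Proof.
elim: k l w => // k IH l w cw sw; have [l0 lw bw _ _] := sw.
have w0 := canonical0 cw lw.
rewrite (extensionsS _ cw _ _ bw) //; first last.
- by move=> c; rewrite !inE => /orP[]/eqP->.
- by rewrite /= inE eq_sym l0.
rewrite /= !big_cons big_nil addn0 !mulnDr.
rewrite (extensions_zero _ _ (state3_zero cw sw)) ?canonical_rcons_mem //.
rewrite (IH l) ?canonical_rcons_mem //; last exact: state3_last.
rewrite (IH (size w)) ?canonical_rcons_size //; last exact: state3_new sw.
rewrite expnS; nia.
Qed.

Lemma state2_extensionsS k b l w : canonical w -> state2 b l w ->
  extensions k.+1 w = extensions k (rcons w 0) + extensions k (rcons w l)
                      + extensions k (rcons w (size w)).
Proof.
move=> cw sw; have [l0 lw _] := sw.
rewrite (@extensionsS _ _ [:: 0; l] cw) /=.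
- by rewrite !big_cons big_nil addn0 addnA.
- by rewrite inE eq_sym l0.
- by move=> c; rewrite lw.
by move=> c; rewrite (state2_not_bad _ sw) lw => ->.
Qed.

(** Both old letters keep the state and the new one leads to [state_last]: the recurrence of
    [state3] again. *)
Lemma extensions2_late k l w : canonical w -> state2 true l w ->
  2 * extensions k w = k.+2 * 2 ^ k.
Proof.
elim: k w => // k IH w cw sw; have [l0 lw _] := sw.
have cw0 : canonical (rcons w 0) by rewrite canonical_rcons_mem ?lw.
have lin : l \in [:: 0; l] by rewrite !inE eqxx orbT.
have cwl : canonical (rcons w l) by rewrite canonical_rcons_mem ?lw.
have s0 := IH _ cw0 (state2_old sw (mem_head _ _)).
have := IH _ cwl; have := state2_old sw lin; rewrite orbT => sl /(_ sl) {}sl.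
rewrite (state2_extensionsS _ cw sw) !mulnDr s0 sl.
rewrite (extensions_last _ _ (state2_new cw sw)) ?canonical_rcons_size //.
rewrite expnS; nia.
Qed.

(** Appending 0 sets the flag, a new letter leads to [state3], and these two counts together are
    (k+2) 2^k; hence E(k+1) = E(k) + (k+2) 2^k. *)
Lemma extensions2 k l w : canonical w -> state2 false l w ->
  extensions k w = k * 2 ^ k + 1.
Proof.
elim: k w => // k IH w cw sw; have [l0 lw _] := sw.
have cw0 : canonical (rcons w 0) by rewrite canonical_rcons_mem ?lw.
have cwl : canonical (rcons w l).
  by rewrite canonical_rcons_mem ?lw ?inE ?eqxx ?orbT.
rewrite (state2_extensionsS _ cw sw) [X in _ + X + _]IH //; last first.
  have := state2_old sw (_ : l \in _); rewrite (negbTE l0); apply.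
  by rewrite !inE eqxx orbT.
have := extensions2_late k cw0 (state2_old sw (mem_head _ _)).
have := extensions3 k (canonical_rcons_size cw) (state2_new cw sw).
rewrite expnS; nia.
Qed.

(** Appending 0 keeps the state and a new letter leads to [state2 false], so each step adds k 2^k +
    1. The power on the left avoids truncated subtraction. *)
Lemma extensions1 k w : canonical w -> state1 w ->
  extensions k w + 2 ^ k.+1 = k + 3 + k * 2 ^ k.
Proof.
elim: k w => // k IH w cw w1; have w0 : 0 \in w by rewrite w1.
rewrite (@extensionsS _ _ [:: 0] cw) //= ; first last.
- move=> c cw'; rewrite inE -w1 cw'; apply/negP => /badP[x [z [u sw]]].
  have /(uniq_leq_size u) // : {subset [:: x; c; z] <= [:: 0]}.
  by move=> t ts; rewrite inE -w1 (mem_subseq sw).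
- by move=> c; rewrite inE w1.
rewrite !big_cons big_nil addn0.
have := IH _ (canonical_rcons_mem cw w0) (state1_zero w1).
rewrite (extensions2 _ (canonical_rcons_size cw) (state1_new w1)).
rewrite !expnS; nia.
Qed.

(** * The list of avoiding canonical words of given length *)

Definition words n : seq (seq nat) := iter n next_words [:: [::]].

Lemma size_words k : size (words k.+1) + 2 ^ k.+1 = k + 3 + k * 2 ^ k.
Proof.
(* The empty word has the single child [[:: 0]]. *)
have -> : size (words k.+1) = extensions k [:: 0] by rewrite /words iterSr.
by apply: extensions1 => // c; rewrite inE.
Qed.

Lemma children_rcons w v c :
  (rcons w c \in children v) =
  [&& w == v, (c \in v) || (c == size v) & ~~ bad v c].
Proof.
apply/mapP/and3P => [[d + /rcons_inj[-> ->]]|[/eqP-> cv nb]].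
  by rewrite mem_filter mem_cat mem_undup inE eqxx => /andP[-> ->].
by exists c => //; rewrite mem_filter mem_cat mem_undup inE nb.
Qed.

Lemma mem_words_rcons n w c :
  (rcons w c \in words n.+1) =
  [&& w \in words n, (c \in w) || (c == size w) & ~~ bad w c].
Proof.
apply/flattenP/and3P => [[_ /mapP[v vw ->]]|[ww cw nb]].
  by rewrite children_rcons => /and3P[/eqP-> -> ->].
exists (children w); first exact: map_f.
by rewrite children_rcons eqxx cw.
Qed.

Lemma mem_words n w :
  w \in words n <-> [/\ size w = n, canonical w & ~ pattern w].
Proof.
elim: n w => [|n IH] w.
  rewrite inE; split=> [/eqP->|[/size0nil->]//].
  by split=> // -[x [y [z []]]].
case/lastP: w => [|w c].
  split=> [|[]//]; case/flattenP => _ /mapP[v _ ->] /mapP[c _].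
  by move/(congr1 size); rewrite size_rcons.
rewrite mem_words_rcons size_rcons canonical_rcons.
split=> [/and3P[/IH[<- cw nw] mc nb]|[[sw] /andP[cw mc] nw]].
  by split; rewrite ?cw ?mc // => /pattern_rcons[//|]; apply/negP.
apply/and3P; split=> //.
  by apply/IH; split=> // pw; apply/nw/pattern_rcons; left.
by apply/negP => bw; apply/nw/pattern_rcons; right.
Qed.

(** A child determines its parent and its last letter, so no word is generated twice. *)
Lemma uniq_words n : uniq (words n).
Proof.
elim: n => //= n IH; apply: allpairs_uniq_dep => // [w /mem_words[_ cw _]|].
  rewrite filter_uniq // cat_uniq undup_uniq /= orbF andbT mem_undup.
  exact: canonical_size_notin.
by move=> [w c] [v d] _ _ /= /rcons_inj[-> ->].
Qed.

End Words.

(** * Words up to renaming of letters, and kernels of functions *)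

Section Kernel.

Lemma pattern_map (T U : eqType) (g : T -> U) (u : seq T) :
  {in u &, injective g} -> pattern (map g u) <-> pattern u.
Proof.
move=> gI; split=> [[x' [y' [z' [+ /subseqP[m sm]]]]]|[x [y [z [uu su]]]]].
  rewrite -map_mask => + e; have := mask_subseq m u; move: e {sm}.
  case: (mask m u) => [|x [|y [|z [|t [|//]]]]] //= [-> -> -> gyt] su.
  have mu := mem_subseq su.
  have yt : y = t by apply: gI => //; apply: mu; rewrite !inE eqxx ?orbT.
  move=> uu.
  exists x, y, z; rewrite -yt in su; split=> //.
  exact: (@map_uniq _ _ g [:: x; y; z]) uu.
exists (g x), (g y), (g z); split.
  rewrite -[[:: g x; _; _]]/(map g [:: x; y; z]) map_inj_in_uniq //.
  apply: sub_in2 gI => t tu; apply: (mem_subseq su); move: tu.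
  by rewrite !inE => /or3P[]/eqP->; rewrite eqxx ?orbT.
by rewrite -/(map g [:: x; y; z; y]) map_subseq.
Qed.

Definition first_index (T : eqType) (u : seq T) : seq nat :=
  [seq index x u | x <- u].

Lemma index_inj_in (T : eqType) (u : seq T) : {in u &, injective (index^~ u)}.
Proof. by move=> x y xu yu e; rewrite -(nth_index x xu) e nth_index. Qed.

(** The position of a first occurrence depends only on which entries coincide. *)
Lemma eq_first_index (S T U : eqType) (f : S -> T) (g : S -> U) (s : seq S) :
  {in s &, forall i j, (f i == f j) = (g i == g j)} ->
  first_index (map f s) = first_index (map g s).
Proof.
move=> fg; rewrite /first_index -!map_comp; apply/eq_in_map => i si /=.
by rewrite /index !find_map; apply: eq_in_find => j sj /=; apply: fg.
Qed.

Lemma canonicalE w : canonical w = (first_index w == w).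
Proof.
rewrite -{3}[w]map_id; apply/allP/eqP => [cw|/eq_in_map cw x xw].
  by apply/eq_in_map => x /cw /eqP.
exact/eqP/cw.
Qed.

Lemma canonical_first_index (T : eqType) (u : seq T) :
  canonical (first_index u).
Proof.
rewrite canonicalE -{2}[u]map_id; apply/eqP/eq_first_index.
exact/inj_in_eq/index_inj_in.
Qed.

End Kernel.

Section KernelPartition.
Variables (I : finType).

(** The partition of [I] into the nonempty fibres of [f]. *)
Definition kernel (T : eqType) (f : I -> T) : {set {set I}} :=
  [set [set j | f j == f i] | i : I].

Lemma eq_kernel (T U : eqType) (f : I -> T) (g : I -> U) :
  kernel f = kernel g <-> forall i j, (f i == f j) = (g i == g j).
Proof.
split=> [e i j|fg]; last first.
  by apply: eq_imset => i; apply/setP => j; rewrite !inE fg.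
(* The fibre of [f] through [i] is a fibre of [g]; since it contains [i], it is the one through
   [i]. *)
have : [set j | f j == f i] \in kernel g by rewrite -e imset_f.
case/imsetP => k _ /setP kE; have := kE i; rewrite !inE eqxx => /esym/eqP gik.
by have := kE j; rewrite !inE -gik eq_sym => ->; rewrite eq_sym.
Qed.

End KernelPartition.

Lemma tau_1_24_3E :
  tau_1_24_3 = kernel (fun i : 'I_4 => nth 0 [:: 0; 1; 2; 1] i).
Proof.
have E k (i : 'I_4) : k < 4 -> (i == inord k) = (val i == k).
  by move=> k4; rewrite -val_eqE /= inordK.
have s0 : [set inord 0] = [set j : 'I_4 | nth 0 [:: 0; 1; 2; 1] j == 0].
  by apply/setP => -[[|[|[|[|//]]]] hi]; rewrite !inE !E.
have s1 : [set inord 1; inord 3]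
    = [set j : 'I_4 | nth 0 [:: 0; 1; 2; 1] j == 1].
  by apply/setP => -[[|[|[|[|//]]]] hi]; rewrite !inE !E.
have s2 : [set inord 2] = [set j : 'I_4 | nth 0 [:: 0; 1; 2; 1] j == 2].
  by apply/setP => -[[|[|[|[|//]]]] hi]; rewrite !inE !E.
rewrite /tau_1_24_3 s0 s1 s2; apply/setP => X; rewrite !inE.
apply/orP/imsetP => [[/orP[]|]/eqP->|[[[|[|[|[|//]]]] hi] _ ->] /=].
- by exists (inord 0); rewrite ?inordK.
- by exists (inord 1); rewrite ?inordK.
- by exists (inord 2); rewrite ?inordK.
- by left; rewrite eqxx.
- by left; rewrite eqxx orbT.
- by right.
- by left; rewrite eqxx orbT.
Qed.

Lemma kernel_tau (T : eqType) (g : nat -> T) :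
  kernel (fun i : 'I_4 => g i) = tau_1_24_3 <->
  uniq [:: g 0; g 1; g 2] /\ g 3 = g 1.
Proof.
rewrite tau_1_24_3E; split=> [/eq_kernel h|[/= + g31]].
  have hk k l : k < 4 -> l < 4 ->
      (g k == g l) = (nth 0 [:: 0; 1; 2; 1] k == nth 0 [:: 0; 1; 2; 1] l).
    by move=> k4 l4; have := h (Ordinal k4) (Ordinal l4).
  by rewrite /= !inE !hk //; split=> //; apply/eqP; rewrite hk.
rewrite !inE negb_or andbT => /andP[/andP[g01 g02] g12].
apply/eq_kernel => -[[|[|[|[|//]]]] hi] -[[|[|[|[|//]]]] hj];
  rewrite /= ?g31 ?eqxx //; apply/negbTE; by rewrite // eq_sym.
Qed.

(** * Set partitions of [n] and their words *)

Section Partitions.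
Variable n : nat.
Implicit Types (P : {set {set 'I_n}}).

Definition word P : seq nat := first_index [seq pblock P i | i <- enum 'I_n].

Lemma size_word P : size (word P) = n.
Proof. by rewrite 2!size_map size_enum_ord. Qed.

Lemma partitionE P : partition P setT -> P = [set pblock P i | i : 'I_n].
Proof.
case/and3P=> /eqP cP tP nP; apply/setP => B; apply/idP/imsetP => [BP|[i _ ->]].
  have /set0Pn[i iB] : B != set0 by apply: contraNneq nP => <-.
  by exists i; rewrite // (def_pblock tP BP iB).
by rewrite pblock_mem // cP inE.
Qed.

Lemma pblock_eqE P i j : partition P setT ->
  (j \in pblock P i) = (pblock P i == pblock P j).
Proof. by case/and3P=> /eqP cP tP _; rewrite eq_pblock ?cP ?inE. Qed.

Lemma nth_word P (i : 'I_n) :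
  nth 0 (word P) i = index (pblock P i) [seq pblock P i | i <- enum 'I_n].
Proof.
rewrite /word /first_index -map_comp (nth_map i) ?size_enum_ord //=.
by rewrite nth_ord_enum.
Qed.

Lemma word_eqE P (i j : 'I_n) :
  (nth 0 (word P) i == nth 0 (word P) j) = (pblock P i == pblock P j).
Proof.
by rewrite !nth_word (inj_in_eq (@index_inj_in _ _)) // map_f ?mem_enum.
Qed.

Lemma word_inj : {in [pred P | partition P setT] &, injective word}.
Proof.
move=> P Q pP pQ eW; rewrite (partitionE pP) (partitionE pQ).
apply: eq_imset => i; apply/setP => j.
by rewrite !pblock_eqE // -!word_eqE eW.
Qed.

(** Positions are grouped by their letter; the word of this partition has the same coincidences as
    [w], and a canonical word is determined by its coincidences. *)
Lemma word_onto w : size w = n -> canonical w ->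
  exists2 P, partition P setT & word P = w.
Proof.
move=> sw cw; pose f (i : 'I_n) := nth 0 w i.
have wE : w = map f (enum 'I_n).
  by rewrite (map_comp (nth 0 w)) val_enum_ord -sw -/(mkseq _ _) mkseq_nth.
exists (preim_partition f setT); first exact: preim_partitionP.
move: cw; rewrite canonicalE => /eqP <-; rewrite wE /word.
set P := preim_partition _ _; apply: eq_first_index => i j _ _.
rewrite -pblock_eqE ?preim_partitionP // pblock_equivalence_partition ?inE //.
by split=> // /eqP->.
Qed.

Lemma rank_in_nth (S : {set 'I_n}) x0 i :
  i < #|S| -> rank_in S (nth x0 (enum S) i) = i.
Proof.
rewrite cardE => iS; set x := nth _ _ _.
(* [enum S] is increasing, so exactly i elements of [S] lie below the one at index i. *)
have sS : sorted <%O (map val (enum S)).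
  rewrite sorted_map /enum_mem -enumT; apply: sorted_filter.
    by move=> ? ? ? /=; apply: lt_trans.
  by rewrite -sorted_map val_enum_ord iota_ltn_sorted.
have := count_lt_nth 0 sS; rewrite size_map => /(_ i iS).
rewrite (nth_map x0) // -/x count_map => <-.
rewrite /rank_in cardsE -size_filter cardE /enum_mem -filter_predI.
congr size; apply: eq_filter => y; by rewrite !inE andbC.
Qed.

(** Standardizing pulls the blocks back along the increasing enumeration of [S]; [x0] is only the
    default value of [nth]. *)
Lemma standardize_kernel P k (S : {set 'I_n}) x0 :
  partition P setT -> #|S| = k ->
  standardize k S (restrict S P) =
  kernel (fun i : 'I_k => pblock P (nth x0 (enum S) i)).
Proof.
move=> pP cS; set e := fun i : 'I_k => nth x0 (enum S) i.
have eS i : e i \in S by rewrite -mem_enum mem_nth // -cardE cS.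
have traceE B : [set i : 'I_k | [exists x in B :&: S, rank_in S x == i]]
    = [set i | e i \in B].
  apply/setP => i; rewrite !inE; apply/existsP/idP => [[x]|eB]; last first.
    by exists (e i); rewrite !inE eB eS rank_in_nth ?cS /=.
  rewrite !inE -andbA => /and3P[xB xS /eqP rx].
  move: xS; rewrite -mem_enum => /(nthP x0)[j]; rewrite -cardE => jS jx.
  by rewrite /e -rx -jx rank_in_nth // jx.
have pB i : [set j | e j \in pblock P (e i)]
    = [set j | pblock P (e j) == pblock P (e i)].
  by apply/setP => j; rewrite !inE pblock_eqE // eq_sym.
apply/setP => X; apply/imsetP/imsetP => [[Y /setD1P[nY /imsetP[B BP YE]] ->]|].
  (* A nonempty trace contains some [e j], and then [B] is the block of [e j]. *)
  rewrite {}YE in nY *; case/set0Pn: nY => x; rewrite inE => /andP[xB xS].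
  move: xS; rewrite -mem_enum => /(nthP x0)[j]; rewrite -cardE cS => jS jx.
  exists (Ordinal jS) => //; rewrite traceE -pB /e /= jx.
  by case/and3P: pP => _ tP _; rewrite (def_pblock tP BP xB).
case=> i _ ->; exists (pblock P (e i) :&: S); last by rewrite traceE pB.
have ee : e i \in pblock P (e i) by rewrite pblock_eqE.
apply/setD1P; split; first by apply/set0Pn; exists (e i); rewrite inE ee eS.
apply/imsetP; exists (pblock P (e i)) => //.
by rewrite {2}(partitionE pP) imset_f.
Qed.

Lemma contains_pattern P : partition P setT ->
  contains P tau_1_24_3 <-> pattern (word P).
Proof.
move=> pP; have iu := @index_inj_in _ [seq pblock P i | i <- enum 'I_n].
split=> [/existsP[S /andP[/eqP cS /eqP tS]]|].
  apply/(pattern_map iu); move: tS.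
  have sS : subseq (enum S) (enum 'I_n).
    by rewrite {1}/enum_mem -enumT filter_subseq.
  have /card_gt0P[x0 _] : 0 < #|S| by rewrite cS.
  rewrite (standardize_kernel x0 pP cS); move: cS sS; rewrite cardE.
  case: (enum S) => [|a [|b [|c [|d [|//]]]]] //= _ sS.
  move/(kernel_tau (fun i => pblock P (nth x0 [:: a; b; c; d] i))) => [uS db].
  exists (pblock P a), (pblock P b), (pblock P c); split=> //.
  by rewrite -{2}db; apply: (map_subseq (pblock P) sS).
case/(pattern_map iu) => [x [y [z [u /subseqP[m _]]]]].
(* The mask selecting the occurrence among the blocks selects four ordinals in increasing order,
   which form [S]. *)
rewrite -map_mask; have := mask_subseq m (enum 'I_n).
case: (mask m _) => [|a [|b [|c [|d [|//]]]]] //= sS [xE yE zE dE].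
set s := [:: a; b; c; d] in sS; pose S := [set i in s].
have eS : enum S = s.
  rewrite [RHS](subseq_uniqP (enum_uniq _) sS) {1}/enum_mem -enumT.
  by apply: eq_filter => i; rewrite -[LHS]/(i \in S) in_set.
have cS : #|S| = 4 by rewrite cardE eS.
apply/existsP; exists S; rewrite cS eqxx /=; apply/eqP.
rewrite (standardize_kernel a pP cS) eS.
apply/(kernel_tau (fun i => pblock P (nth a s i))).
by rewrite /= -xE -yE -zE -dE.
Qed.

(** The map [word] is a bijection between the avoiders and the listed words. *)
Lemma card_avoiders : #|avoiders n tau_1_24_3| = size (words n).
Proof.
rewrite cardE -(size_map word); apply/perm_size/uniq_perm.
- rewrite map_inj_in_uniq ?enum_uniq // => P Q; rewrite !mem_enum !inE.
  by case/andP=> pP _ /andP[pQ _]; apply: word_inj.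
- exact: uniq_words.
move=> w; apply/mapP/idP => [[P + ->]|/mem_words[sw cw nw]].
  rewrite mem_enum inE => /andP[pP /negP aP]; apply/mem_words.
  split; [exact: size_word|exact: canonical_first_index|].
  by move/contains_pattern => /(_ pP).
have [P pP eP] := word_onto sw cw; exists P => //.
rewrite mem_enum inE pP; apply/negP => /contains_pattern; rewrite eP => /(_ pP).
exact: nw.
Qed.

End Partitions.

(** * Coefficients of power series and the closed form *)

Section PowerSeries.
Local Open Scope ring_scope.
Variable R : comNzRingType.
Implicit Types f g : fps R.

Lemma fcoefD f g n : fcoef (f + g) n = fcoef f n + fcoef g n.
Proof. by []. Qed.

Lemma fcoefN f n : fcoef (- f) n = - fcoef f n.
Proof. by []. Qed.

Lemma fcoefMn f k n : fcoef (f *+ k) n = fcoef f n *+ k.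
Proof. by elim: k => // k IH; rewrite !mulrS fcoefD IH. Qed.

Lemma fcoef_mul_nat k f n : fcoef (k%:R * f) n = k%:R * fcoef f n.
Proof. by rewrite !mulr_natl fcoefMn. Qed.

Lemma fcoefMX f n : fcoef (f * fpsX R) n = if n is m.+1 then fcoef f m else 0.
Proof.
rewrite fcoefM; case: n => [|n]; first by rewrite big_ord1 mulr0.
rewrite big_ord_recr big_ord_recr /= subnn mulr0 addr0 subSnn mulr1.
rewrite big1 ?add0r // => i _; rewrite subSn; last exact: ltnW.
by rewrite eqSS subn_eq0 leqNgt ltn_ord mulr0.
Qed.

End PowerSeries.

Local Open Scope ring_scope.

Lemma ogf1_closed_form (a : nat -> nat) :
  (forall k, (a k.+1 + 2 ^ k.+1 = k + 3 + k * 2 ^ k)%N) ->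
  let z : fps rat := fpsX rat in
  ogf1 rat a =
  (z - 4%:R * z ^+ 2 + 6%:R * z ^+ 3 - 2%:R * z ^+ 4)
    / (1 - 3%:R * z + 2%:R * z ^+ 2) ^+ 2.
Proof.
move=> ha z.
have {}ha k : (a k.+1)%:R = k%:R + 3%:R + (k%:R - 2%:R) * 2%:R ^+ k :> rat.
  have /(congr1 (fun m => m%:R : rat)) := ha k.
  by rewrite !natrD natrM !natrX exprS => h; lra.
have uD : (1 - 3%:R * z + 2%:R * z ^+ 2) ^+ 2 \is a GRing.unit.
  rewrite unitrX // fps_unitE !fcoefD fcoefN !fcoef_mul_nat.
  by rewrite expr2 fcoefMX /= !mulr0 subr0 addr0 unitr1.
apply: (mulIr uD); rewrite divrK //.
set A := ogf1 _ _.
(* Horner form reduces every coefficient to shifts by [fcoefMX]; the constants come from (1 - 3z +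
   2z^2)^2 = 1 - 6z + 13z^2 - 12z^3 + 4z^4. *)
rewrite [LHS](_ : _ = ((((4%:R * A) * z - 12%:R * A) * z + 13%:R * A) * z
  - 6%:R * A) * z + A); last by ring.
rewrite [RHS](_ : _ = ((((- 2%:R * 1) * z + 6%:R * 1) * z - 4%:R * 1) * z
  + 1) * z); last by ring.
apply/fpsP => n.
(* Up to index 4 the numerator and the zero constant term of [A] intervene; beyond, only the
   recurrence between values given by [ha] remains. *)
case: n => [|[|[|[|[|n]]]]];
  rewrite !(fcoefD, fcoefN, fcoefMX, fcoef_mul_nat, mulNr, fcoef1) /=
    ?ha ?exprS; ring.
Qed.

Theorem theorem4p4 :
  let z : fps rat := fpsX rat in
  ogf1 rat (fun n => #|avoiders n tau_1_24_3|) =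
  (z - 4%:R * z ^+ 2 + 6%:R * z ^+ 3 - 2%:R * z ^+ 4)
    / (1 - 3%:R * z + 2%:R * z ^+ 2) ^+ 2.
Proof.
by apply: ogf1_closed_form => k; rewrite card_avoiders size_words.
Qed.
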